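(* There exists a universal covering (in the sense defined in the context) whose area is at most $0.8441153$.
   Context: For a set $A \subseteq \mathbb{R}^2$, its diameter is $\mathrm{diam}(A) = \sup\{d(x,y) : x,y \in A\}$, where $d$ is the Euclidean distance. A universal covering is a convex set $U \subseteq \mathbb{R}^2$ such that every set $A \subseteq \mathbb{R}^2$ with $\mathrm{diam}(A) = 1$ is isometric to some subset $B \subseteq U$. Here isometric means related by a Euclidean isometry of the plane, i.e. a composition of translations, rotations and reflections. Area means Lebesgue measure in $\mathbb{R}^2$. *)

(* Defs.v *)
From HB Require Import structures.
From mathcomp Require Import all_boot all_order all_algebra.
From mathcomp Require Import all_classical all_reals all_analysis.
Set Implicit Arguments. Unset Strict Implicit. Unset Printing Implicit Defensive.
Import Order.TTheory GRing.Theory Num.Theory.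
Local Open Scope classical_set_scope.
Local Open Scope ring_scope.

Section Plane.
Variable R : realType.

Definition dist2 (x y : R * R) : R :=
  Num.sqrt ((x.1 - y.1) ^+ 2 + (x.2 - y.2) ^+ 2).

Definition diam (A : set (R * R)) : \bar R :=
  ereal_sup [set (dist2 x y)%:E | x in A & y in A].

(* Euclidean isometries of the plane: compositions of translations,
   rotations and reflections, i.e. x |-> Q x + t with Q orthogonal. *)
Definition euclid_isometry (f : R * R -> R * R) : Prop :=
  exists (c s t1 t2 : R) (refl : bool), c ^+ 2 + s ^+ 2 = 1 /\
    forall p : R * R, f p =
      if refl then (c * p.1 + s * p.2 + t1, s * p.1 - c * p.2 + t2)
      else (c * p.1 - s * p.2 + t1, s * p.1 + c * p.2 + t2).

Definition convex_set2 (U : set (R * R)) : Prop :=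
  forall x y : R * R, U x -> U y -> forall t : R, 0 <= t <= 1 ->
    U ((1 - t) * x.1 + t * y.1, (1 - t) * x.2 + t * y.2).

Definition universal_covering (U : set (R * R)) : Prop :=
  convex_set2 U /\
  forall A : set (R * R), diam A = 1%:E ->
    exists f : R * R -> R * R, euclid_isometry f /\ f @` A `<=` U.

Definition area (U : set (R * R)) : \bar R :=
  ((@lebesgue_measure R) \x (@lebesgue_measure R))%E U.

End Plane.

(* Main.v *)
Require Import Defs.
From HB Require Import structures.
From mathcomp Require Import all_boot all_order all_algebra.
From mathcomp Require Import all_classical all_reals all_analysis.
From mathcomp Require Import measurable_realfun ring lra.
Import Order.TTheory GRing.Theory Num.Theory.
Import numFieldNormedType.Exports.
Local Open Scope classical_set_scope.
Local Open Scope ring_scope.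

(** Every set of diameter 1 lies in a complete one [K] (adding any point would
    increase the diameter), which has constant width 1.  Rotating [K], an
    intermediate value argument makes the midlines of three strips of width 1 at
    60 degrees concurrent, so that [K] is inscribed in a regular hexagon with
    contact points on opposite sides facing each other.  For any direction [n],
    [K] avoids one of the opposite half-planes [n . p > 1/2], [- n . p > 1/2].

    As in Pal's cover, this is used for the corners of the hexagon, but with cuts
    tilted by a small angle sigma.  Some two corners that are two apart are
    avoided; rotate them to 90 and 210 degrees.  Avoiding a corner moves the
    contact points on the adjacent sides away from it, and then the corner at -30
    degrees can be shaved along the unit circles around the extreme contact
    points opposite to it (Sprague's arcs).  The tilt makes one of these arcs
    longer and the other one shorter; but the shorter one can be taken as for
    sigma = 0: if the contact point at 180 degrees is too low for this, then
    the corners for the tilt - sigma show that either the corner at -30 degrees is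
    avoided anyway, or a reflected position of [K] works.  The gain of this
    trick is linear in sigma, the loss is quadratic.  The cover is the polygon
    obtained with tan (sigma / 2) = 1 / 90 and five tangents to each arc. *)

Local Arguments Nat.of_num_uint : simpl never.

(** * Complete sets *)

Section CompleteSets.
Context {R : realType}.
Implicit Types (A K : set (R * R)) (p q z v : R * R).

Definition dsq p q : R := (p.1 - q.1) ^+ 2 + (p.2 - q.2) ^+ 2.

Definition unit_diam A := forall p q, A p -> A q -> dsq p q <= 1.

(** Equivalently, [K] is the intersection of the closed unit discs centred at its points. *)
Definition complete K :=
  unit_diam K /\ forall z, (forall k, K k -> dsq z k <= 1) -> K z.

Definition dot v p : R := v.1 * p.1 + v.2 * p.2.

Lemma dsqC p q : dsq p q = dsq q p.
Proof. by rewrite /dsq; ring. Qed.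

Lemma dsqxx p : dsq p p = 0.
Proof. by rewrite /dsq; ring. Qed.

Lemma diam_unit A : diam A = 1%:E -> unit_diam A.
Proof.
move=> dA p q Ap Aq.
have : ((dist2 p q)%:E <= diam A)%E.
  by apply: ereal_sup_ubound; exists p => //; exists q.
rewrite dA lee_fin /dist2 => h; rewrite /dsq.
by rewrite -[leLHS]sqr_sqrtr ?addr_ge0 ?sqr_ge0// expr_le1// sqrtr_ge0.
Qed.

(** Zorn's lemma, for the property that the union of [A] and [X] has diameter at most 1. Including
    [A] keeps the empty chain admissible, and a maximal [X] absorbs [A]. *)
Lemma unit_diam_complete A : unit_diam A -> exists K, A `<=` K /\ complete K.
Proof.
move=> dA.
have [|K [dK maxK]] := @Zorn_bigcup _ (fun X => unit_diam (A `|` X)).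
  move=> F FP tot p q [Ap|[X FX Xp]] [Aq|[Y FY Yq]].
  - exact: dA.
  - by apply: (FP _ FY); [left|right].
  - by apply: (FP _ FX); [right|left].
  - have [XY|YX] := tot _ _ FX FY.
    + by apply: (FP _ FY); right => //; apply: XY.
    + by apply: (FP _ FX); right => //; apply: YX.
have addK z : (forall k, (A `|` K) k -> dsq z k <= 1) -> K z.
  move=> zK; apply: contrapT => nKz.
  apply: (maxK (K `|` [set z])).
    by split; [move=> x; left|move=> h; apply/nKz/h; right].
  have K' k : (A `|` (K `|` [set z])) k -> (A `|` K) k \/ k = z.
    by move=> [?|[?|?]]; [left; left|left; right|right].
  move=> p q /K'[p1|->] /K'[q1|->]; [exact: dK| |exact: zK|].
    by rewrite dsqC; exact: zK.
  by rewrite dsqxx.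
have AK : A `<=` K.
  by move=> p Ap; apply: addK => k; apply: dK; left.
have e : A `|` K = K by apply/seteqP; split=> [x [/AK|]|x Kx] //; right.
by rewrite e in dK addK; exists K; split=> //; split.
Qed.

Lemma continuous_dsq q : continuous (dsq ^~ q).
Proof.
move=> p; rewrite /dsq /=.
apply: (@continuousD _ _ _ (fun x : R * R => (x.1 - q.1) ^+ 2)
  (fun x : R * R => (x.2 - q.2) ^+ 2)).
  apply: (@continuous_comp _ _ _ (fun x : R * R => x.1 - q.1) (fun y : R => y ^+ 2)).
    by apply: continuousB; [exact: cvg_fst|exact: cvg_cst].
  exact: exprn_continuous.
apply: (@continuous_comp _ _ _ (fun x : R * R => x.2 - q.2) (fun y : R => y ^+ 2)).
  by apply: continuousB; [exact: cvg_snd|exact: cvg_cst].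
exact: exprn_continuous.
Qed.

Lemma continuous_dot v : continuous (dot v).
Proof.
move=> p; apply: (@continuousD _ _ _ (fun x : R * R => v.1 * x.1)
  (fun x : R * R => v.2 * x.2)); apply: continuousM.
- exact: cvg_cst.
- exact: cvg_fst.
- exact: cvg_cst.
- exact: cvg_snd.
Qed.

Lemma complete_compact K : complete K -> compact K.
Proof.
move=> [dK cK]; have [-> |/set0P [c Kc]] := eqVneq K set0; first exact: compact0.
have -> : K = \bigcap_(k in K) [set z | dsq z k <= 1].
  apply/seteqP; split=> z; first by move=> Kz k Kk; exact: dK.
  by move=> h; apply: cK => k; exact: h.
apply: (@subclosed_compact _ _ (`[c.1 - 1, c.1 + 1] `*` `[c.2 - 1, c.2 + 1])).
- apply: closed_bigI => k _.
  apply: (@closed_comp _ _ (dsq ^~ k) [set t | t <= 1]).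
    by move=> x _; exact: continuous_dsq.
  exact: closed_le.
- by apply: compact_setX; exact: segment_compact.
- move=> z /(_ _ Kc) /=; rewrite /dsq => h.
  have h1 : (z.1 - c.1) ^+ 2 <= 1 by have := sqr_ge0 (z.2 - c.2); lra.
  have h2 : (z.2 - c.2) ^+ 2 <= 1 by have := sqr_ge0 (z.1 - c.1); lra.
  by split; rewrite /= in_itv /=; apply/andP; split; nra.
Qed.

Lemma complete_max K v : complete K -> K !=set0 ->
  exists2 p, K p & forall q, K q -> dot v q <= dot v p.
Proof.
move=> cK K0.
have [|p /set_mem Kp pmax] := compact_EVT_max K0 (complete_compact _ cK) (f := dot v).
  by apply: continuous_subspaceT; exact: continuous_dot.
by exists p => // q Kq; apply: pmax; exact: mem_set.
Qed.

End CompleteSets.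

(** * Antipodes of support points of complete sets *)

Section ConstantWidth.
Context {R : realType}.
Implicit Types (K : set (R * R)) (p q z v d n : R * R).

(** The last hypothesis puts the point [t d + u d'], with [d'] the left normal [(- d2, d1)], between
    the chord from 0 to [d] and the unit arc on its left. A point [e] within 1 of both ends
    satisfies [- h <= e . d'], and the squared distance decreases in [e . d']. *)
Lemma lens_chord (d1 d2 e1 e2 t u : R) :
  let a2 := d1 ^+ 2 + d2 ^+ 2 in
  let h := Num.sqrt (a2 - a2 ^+ 2 / 4) in
  0 <= t <= 1 -> 0 <= u -> 0 <= a2 <= 1 ->
  e1 ^+ 2 + e2 ^+ 2 <= 1 -> (e1 - d1) ^+ 2 + (e2 - d2) ^+ 2 <= 1 ->
  u ^+ 2 * a2 + 2 * u * h <= t * (1 - t) * a2 ->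
  (e1 - (t * d1 - u * d2)) ^+ 2 + (e2 - (t * d2 + u * d1)) ^+ 2 <= 1.
Proof.
move=> a2 h /andP[t0 t1] u0 /andP[a0 a1] he hed hu.
have hE : h ^+ 2 = a2 - a2 ^+ 2 / 4 by rewrite sqr_sqrtr //; nra.
have h0 : 0 <= h by rewrite sqrtr_ge0.
set en := - e1 * d2 + e2 * d1.
have en2 : en ^+ 2 <= h ^+ 2.
  rewrite hE; have -> : en ^+ 2 = a2 * ((e1 ^+ 2 + e2 ^+ 2) / 2 +
    ((e1 - d1) ^+ 2 + (e2 - d2) ^+ 2) / 2 - a2 / 4) -
    (e1 * d1 + e2 * d2 - a2 / 2) ^+ 2 by rewrite /en /a2; field.
  have := sqr_ge0 (e1 * d1 + e2 * d2 - a2 / 2); nra.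
have enh : - h <= en by move: en2; rewrite -[h ^+ 2]sqrrN => ?; nra.
have -> : (e1 - (t * d1 - u * d2)) ^+ 2 + (e2 - (t * d2 + u * d1)) ^+ 2 =
  (1 - t) * (e1 ^+ 2 + e2 ^+ 2) + t * ((e1 - d1) ^+ 2 + (e2 - d2) ^+ 2)
  - t * (1 - t) * a2 + u ^+ 2 * a2 - 2 * u * en by rewrite /en /a2; ring.
have : (1 - t) * (e1 ^+ 2 + e2 ^+ 2) <= 1 - t by nra.
have : t * ((e1 - d1) ^+ 2 + (e2 - d2) ^+ 2) <= t by nra.
have : - u * en <= u * h by nra.
lra.
Qed.

(* Two points [p], [z] of a complete set span a whole lens of unit arcs inside
   the set; if [z] were at distance more than 1 from [p - v], that lens would
   cross the supporting line at [p]. *)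
Lemma complete_antipode K v p : complete K -> v.1 ^+ 2 + v.2 ^+ 2 = 1 ->
  K p -> (forall q, K q -> dot v q <= dot v p) ->
  K (p.1 - v.1, p.2 - v.2).
Proof.
move=> [dK cK] v1 Kp pmax; apply: (cK) => z Kz; rewrite leNgt; apply/negP => far.
set d1 := z.1 - p.1; set d2 := z.2 - p.2.
pose a2 := d1 ^+ 2 + d2 ^+ 2; pose al := d1 * v.1 + d2 * v.2.
have [w Kw wv] : exists2 w, K w & dot v p < dot v w; last first.
  by have := pmax _ Kw; rewrite leNgt wv.
have al0 : al <= 0 by have := pmax _ Kz; rewrite /dot /al /d1 /d2; lra.
have aal : - 2 * al < a2.
  move: far; rewrite /dsq /= /al /a2 /d1 /d2 => far.
  by move: v1 far; nra.
have a2le : a2 <= 1 by have := dK _ _ Kz Kp.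
have a2gt : 0 < a2 by lra.
pose h := Num.sqrt (a2 - a2 ^+ 2 / 4).
have hE : h ^+ 2 = a2 - a2 ^+ 2 / 4 by rewrite sqr_sqrtr //; nra.
have h_gt0 : 0 < h by rewrite sqrtr_gt0; nra.
have dsqE k : K k -> (k.1 - p.1) ^+ 2 + (k.2 - p.2) ^+ 2 <= 1.
  by move=> Kk; exact: dK _ _ Kk Kp.
have dsqE' k : K k -> (k.1 - p.1 - d1) ^+ 2 + (k.2 - p.2 - d2) ^+ 2 <= 1.
  move=> Kk; have := dK _ _ Kk Kz; rewrite /dsq /d1 /d2.
  by congr (_ <= _); ring.
pose be := `|d1 * v.2 - d2 * v.1|.
have beE : be ^+ 2 = a2 - al ^+ 2.
  rewrite /be real_normK ?num_real //.
  have -> : a2 = a2 * (v.1 ^+ 2 + v.2 ^+ 2) by rewrite v1 mulr1.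
  by rewrite /a2 /al; ring.
have be_gt0 : 0 < be.
  rewrite lt_def normr_ge0 andbT; apply/eqP => be0.
  by move: beE; rewrite be0 expr0n /=; nra.
(* At [p], the supporting line makes a smaller angle with the chord to [z] than the arc does. After
   squaring, this reduces to [4 * al ^+ 2 < a2 ^+ 2], which follows from [aal]. *)
have lt_slope : - al * (2 * h) < a2 * be.
  rewrite -(@ltr_pXn2r _ 2) ?nnegrE //;
    [|by apply: mulr_ge0; lra|by apply: mulr_ge0; lra].
  rewrite !exprMn hE beE.
  have : al ^+ 2 * 4 < a2 ^+ 2 by nra.
  move=> hal; have : 0 < a2 * (a2 ^+ 2 - al ^+ 2 * 4) by rewrite mulr_gt0 // subr_gt0.
  nra.
(* The mean of [- al / be], above which a ray from [p] crosses the supporting line, and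
   [a2 / (2 * h)], the slope of the arc at [p], both relative to the chord. *)
pose ka := (a2 * be - al * (2 * h)) / (4 * h * be).
have hb : 0 < h * be by rewrite mulr_gt0.
have ka_be : - al < ka * be.
  have -> : ka * be = (a2 * be - al * (2 * h)) / (4 * h).
    by rewrite /ka; field; rewrite !gt_eqF.
  by rewrite ltr_pdivlMr; lra.
have ka_h : 2 * ka * h < a2.
  have -> : 2 * ka * h = (a2 * be - al * (2 * h)) / (2 * be).
    by rewrite /ka; field; rewrite !gt_eqF.
  by rewrite ltr_pdivrMr; lra.
have ka0 : 0 <= ka by rewrite /ka divr_ge0 //; nra.
(* With this [t] the ray of slope [ka] meets the arc again, so [hu] is an equality. *)
pose t := (a2 - 2 * ka * h) / (a2 * (1 + ka ^+ 2)).
have dpos : 0 < a2 * (1 + ka ^+ 2) by rewrite mulr_gt0 //; nra.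
have t_gt0 : 0 < t by rewrite divr_gt0 //; lra.
have t_le1 : t <= 1 by rewrite ler_pdivrMr // mul1r; nra.
have tE : t * (a2 * (1 + ka ^+ 2)) = a2 - 2 * ka * h.
  by rewrite /t mulfVK // gt_eqF.
have hu : (t * ka) ^+ 2 * a2 + 2 * (t * ka) * h <= t * (1 - t) * a2.
  have -> : t * (1 - t) * a2 = t * (a2 - t * a2) by ring.
  have -> : (t * ka) ^+ 2 * a2 + 2 * (t * ka) * h =
    t * (t * (a2 * (1 + ka ^+ 2)) - t * a2 + 2 * ka * h) by ring.
  by rewrite tE; apply/ler_wpM2l; lra.
have u0 : 0 <= t * ka by rewrite mulr_ge0 // ltW.
have t01 : 0 <= t <= 1 by rewrite t_le1 ltW.
have a01 : 0 <= a2 <= 1 by rewrite a2le ltW.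
have beN : 0 < t * (ka * be + al) by rewrite mulr_gt0 //; lra.
(* The arc must be on the side of the chord to which [v] points. When this is the right side,
   [lens_chord] is applied after negating second coordinates. *)
case: (lerP 0 (d1 * v.2 - d2 * v.1)) => sgn.
- exists (p.1 + (t * d1 - t * ka * d2), p.2 + (t * d2 + t * ka * d1)).
  + apply: (cK) => k Kk.
    have := lens_chord d1 d2 _ _ _ _ t01 u0 a01 (dsqE _ Kk) (dsqE' _ Kk) hu.
    by rewrite /dsq /=; congr (_ <= _); ring.
  + move: beN; rewrite /be ger0_norm // /dot /= /al => ?; lra.
- exists (p.1 + (t * d1 + t * ka * d2), p.2 + (t * d2 - t * ka * d1)).
  + apply: (cK) => k Kk.
    have hu' : (t * ka) ^+ 2 * (d1 ^+ 2 + (- d2) ^+ 2) +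
       2 * (t * ka) * Num.sqrt (d1 ^+ 2 + (- d2) ^+ 2 -
       (d1 ^+ 2 + (- d2) ^+ 2) ^+ 2 / 4) <= t * (1 - t) * (d1 ^+ 2 + (- d2) ^+ 2).
      by rewrite sqrrN.
    have a01' : 0 <= d1 ^+ 2 + (- d2) ^+ 2 <= 1 by rewrite sqrrN.
    have e1 : (k.1 - p.1) ^+ 2 + (- (k.2 - p.2)) ^+ 2 <= 1 by rewrite sqrrN dsqE.
    have e2 : (k.1 - p.1 - d1) ^+ 2 + (- (k.2 - p.2) - - d2) ^+ 2 <= 1.
      by have := dsqE' _ Kk; congr (_ <= _); ring.
    have := lens_chord d1 (- d2) _ _ _ _ t01 u0 a01' e1 e2 hu'.
    by rewrite /dsq /=; congr (_ <= _); ring.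
  + move: beN; rewrite /be ltr0_norm // /dot /= /al => ?; lra.
Qed.

End ConstantWidth.

(** * The inscribed hexagon *)

Section InscribedHexagon.
Context {R : realType}.
Implicit Types (K : set (R * R)) (p q v w : R * R).

Definition sqrt3 : R := Num.sqrt 3.
Local Notation s3 := sqrt3.

Lemma sqr_sqrt3 : s3 ^+ 2 = 3.
Proof. by rewrite /sqrt3 sqr_sqrtr. Qed.

Lemma sqrt3_ge0 : 0 <= s3.
Proof. exact: sqrtr_ge0. Qed.

(** Rotation by 60 degrees. *)
Definition rot p : R * R := (p.1 / 2 - s3 / 2 * p.2, s3 / 2 * p.1 + p.2 / 2).

(** For a unit [w], these are facing points on the two lines bounding the strip of width 1
    orthogonal to [w] and centred at 0; [y] is their common offset along [w] turned by 90
    degrees. *)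
Definition touches K w (y : R) :=
  K (w.1 / 2 - y * w.2, w.2 / 2 + y * w.1) /\
  K (- w.1 / 2 - y * w.2, - w.2 / 2 + y * w.1).

Definition inscribed K (y0 y1 y2 : R) := [/\ unit_diam K,
  touches K (1, 0) y0, touches K (rot (1, 0)) y1 & touches K (rot (rot (1, 0))) y2].

Lemma lipschitz_continuous (f : R -> R) (C : R) :
  (forall x y, f x - f y <= C * `|x - y|) -> continuous f.
Proof.
move=> fC x; apply/cvgrPdist_le => e e0.
have C0 : 0 < `|C| + 1 by rewrite ltr_wpDl.
near=> y.
have xy : `|x - y| <= e / (`|C| + 1).
  by near: y; apply: cvgr_dist_le => //; rewrite divr_gt0.
have : (`|C| + 1) * `|x - y| <= e by rewrite mulrC -ler_pdivlMr.
have h : C * `|x - y| <= (`|C| + 1) * `|x - y|.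
  by rewrite ler_wpM2r // (le_trans (ler_norm C)) // lerDl.
have := fC x y; have := fC y x; rewrite (distrC y x) => h1 h2 h3.
by rewrite ler_norml; apply/andP; split; lra.
Unshelve. all: by end_near.
Qed.

Lemma support_function K : complete K -> exists H : R * R -> R,
  forall v, (exists2 p, K p & dot v p = H v) /\
    forall q, K q -> dot v q <= H v.
Proof.
move=> cK; have K0 : K !=set0.
  apply/set0P/negP => /eqP K0; suff : K (0, 0) by rewrite K0.
  by apply: cK.2 => k; rewrite K0.
suff /choice[H HP] : forall v, exists h, (exists2 p, K p & dot v p = h) /\
  forall q, K q -> dot v q <= h by exists H.
move=> v; have [p Kp pmax] := complete_max _ v cK K0.
by exists (dot v p); split=> //; exists p.
Qed.

(** * Constant width and the midlines of strips *)

Section Support.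
Variables (K : set (R * R)) (H : R * R -> R).
Hypothesis cK : complete K.
Hypothesis HP : forall v, (exists2 p, K p & dot v p = H v) /\
  forall q, K q -> dot v q <= H v.

Lemma support_homogeneous v l : 0 <= l -> H (l * v.1, l * v.2) = l * H v.
Proof.
move=> l0; apply/eqP; rewrite eq_le; apply/andP; split.
  have [[p Kp <-] _] := HP (l * v.1, l * v.2).
  have /= := ler_wpM2l l0 ((HP v).2 _ Kp).
  by rewrite /dot /=; congr (_ <= _); ring.
have [[p Kp <-] _] := HP v.
have := (HP (l * v.1, l * v.2)).2 _ Kp.
by rewrite /dot /=; congr (_ <= _); ring.
Qed.

Lemma support_continuous (a b c d : R) :
  continuous (fun t => H (a + b * t, c + d * t)).
Proof.
have [[z Kz _] _] := HP (0, 0).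
pose C := `|b| * (`|z.1| + 1) + `|d| * (`|z.2| + 1).
apply: (@lipschitz_continuous _ C) => x y.
have [[p Kp <-] _] := HP (a + b * x, c + d * x).
have := (HP (a + b * y, c + d * y)).2 _ Kp.
have := cK.1 _ _ Kp Kz; rewrite /dsq => hd.
have bnd (e f : R) : (e - f) ^+ 2 <= 1 -> `|e| <= `|f| + 1.
  move=> h; have : `|e - f| <= 1 by rewrite ler_norml; apply/andP; split; nra.
  by have := ler_normD (e - f) f; rewrite subrK; lra.
have p1 : `|p.1| <= `|z.1| + 1 by apply: bnd; have := sqr_ge0 (p.2 - z.2); lra.
have p2 : `|p.2| <= `|z.2| + 1 by apply: bnd; have := sqr_ge0 (p.1 - z.1); lra.
have q1 : b * (x - y) * p.1 <= `|b| * (`|z.1| + 1) * `|x - y|.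
  rewrite (le_trans (ler_norm _)) // !normrM mulrAC ler_wpM2r //.
  exact: ler_wpM2l.
have q2 : d * (x - y) * p.2 <= `|d| * (`|z.2| + 1) * `|x - y|.
  rewrite (le_trans (ler_norm _)) // !normrM mulrAC ler_wpM2r //.
  exact: ler_wpM2l.
by rewrite /dot /= /C; lra.
Qed.

(** The antipode [p - v] of a support point [p] makes the width at least 1; the diameter bounds it
    by 1. *)
Lemma support_width v : v.1 ^+ 2 + v.2 ^+ 2 = 1 ->
  H (- v.1, - v.2) = 1 - H v.
Proof.
move=> v1; have [[p Kp pv] pmax] := HP v.
have Kpv : K (p.1 - v.1, p.2 - v.2).
  by apply: complete_antipode => // q Kq; rewrite pv; exact: pmax.
apply/eqP; rewrite eq_le; apply/andP; split; last first.
  have := (HP (- v.1, - v.2)).2 _ Kpv; rewrite /dot /= -pv /dot => h.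
  by rewrite -v1; lra.
have [[q Kq <-] _] := HP (- v.1, - v.2).
have := cK.1 _ _ Kp Kq; rewrite -pv /dsq /dot /= => h.
have : (v.1 * (p.1 - q.1) + v.2 * (p.2 - q.2)) ^+ 2 <= 1.
  have := sqr_ge0 (v.1 * (p.2 - q.2) - v.2 * (p.1 - q.1)).
  have : (v.1 ^+ 2 + v.2 ^+ 2) * ((p.1 - q.1) ^+ 2 + (p.2 - q.2) ^+ 2) <= 1.
    by rewrite v1 mul1r.
  lra.
nra.
Qed.

(** For a unit [v], the midline of the strip orthogonal to [v] is [dot v p = mid v]. *)
Let mid v := (H v - H (- v.1, - v.2)) / 2.

(* The signed failure of concurrency of the midlines of the three strips
   orthogonal to [v], [rot v], [rot (rot v)] changes sign under [rot]. *)
Lemma concurrent_midlines : exists v, v.1 ^+ 2 + v.2 ^+ 2 = 1 /\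
  mid (rot v) = mid v + mid (rot (rot v)).
Proof.
(* A segment from [(1, 0)] to [rot (1, 0)] replaces the circular arc; since [mid] is positively
   homogeneous, the direction found can be normalised at the end. As [rot v = v + rot (rot v)], a
   zero of [g] means concurrency. *)
pose path t : R * R := (1 - t / 2, s3 / 2 * t).
pose g t := mid (path t) - mid (rot (path t)) + mid (rot (rot (path t))).
have ext (F G : R -> R) t : (forall x, F x = G x) ->
    {for t, continuous F} -> {for t, continuous G}.
  by move=> /funext ->.
have s2 := sqr_sqrt3.
have s2' : s3 * s3 = 3 by rewrite -expr2.
have cmid (a b c d : R) : continuous (fun t : R => mid (a + b * t, c + d * t)).
  move=> t; apply: (@continuousM _ _
    (fun x : R => H (a + b * x, c + d * x) - H (- (a + b * x), - (c + d * x)))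
    (fun=> 2^-1)); last exact: cvg_cst.
  apply: (@continuousB _ _ _ (fun x : R => H (a + b * x, c + d * x))
    (fun x : R => H (- (a + b * x), - (c + d * x)))).
    exact: support_continuous.
  apply: ext (@support_continuous (- a) (- b) (- c) (- d) t) => x.
  by congr H; congr pair; rewrite opprD mulNr.
have cg : continuous g.
  move=> t; apply: (@continuousD _ _ _
    (fun t => mid (path t) - mid (rot (path t))) (fun t => mid (rot (rot (path t))))).
  apply: (@continuousB _ _ _ (mid \o path) (fun t => mid (rot (path t)))).
  - apply: ext (cmid 1 (- (1 / 2)) 0 (s3 / 2) t) => x.
    by congr mid; congr pair; rewrite /=; field.
  - apply: ext (cmid (1 / 2) (- 1) (s3 / 2) 0 t) => x.
    congr mid; rewrite /rot /path /=; congr pair; last by field.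
    have -> : s3 / 2 * (s3 / 2 * x) = s3 ^+ 2 * x / 4 by field.
    by rewrite s2; field.
  - apply: ext (cmid (- (1 / 2)) (- (1 / 2)) (s3 / 2) (- (s3 / 2)) t) => x.
    have e3 : s3 * s3 * x = 3 * x by rewrite s2'.
    have e4 : s3 * (s3 * s3) * x = s3 * 3 * x by rewrite s2'.
    by congr mid; rewrite /rot /path /=; congr pair; lra.
(* [path 1] is [rot (path 0)]: the same three strips occur, shifted cyclically, with one direction
   reversed. *)
have g1 : g 1 = - g 0.
  have m3 : mid (rot (rot (path 1))) = - mid (path 0).
    rewrite /mid; have -> : rot (rot (path 1)) = (- (path 0).1, - (path 0).2).
      have e4 : s3 * (s3 * s3) = s3 * 3 by rewrite s2'.
      by rewrite /rot /path /=; congr pair; lra.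
    by rewrite /= !opprK; field.
  have m2 : mid (rot (path 1)) = mid (rot (rot (path 0))).
    by congr mid; rewrite /rot /path /=; congr pair; lra.
  have m1 : mid (path 1) = mid (rot (path 0)).
    by congr mid; rewrite /rot /path /=; congr pair; lra.
  by rewrite /g m3 m2 m1; ring.
have [t t01 gt] : exists2 t, t \in `[0, 1] & g t = 0.
  apply: IVT => //; first by apply: continuous_subspaceT.
  by rewrite g1 ge_min le_max; case: (lerP 0 (g 0)) => h0; apply/andP; split; lra.
have [v vE] : exists v, v = path t by exists (path t).
pose N := Num.sqrt (v.1 ^+ 2 + v.2 ^+ 2).
have N2 : N ^+ 2 = v.1 ^+ 2 + v.2 ^+ 2 by rewrite sqr_sqrtr // addr_ge0 // sqr_ge0.
have N0 : 0 < N.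
  rewrite sqrtr_gt0 ltr_wpDr ?sqr_ge0 // exprn_gt0 //.
  by rewrite vE /=; move: t01; rewrite in_itv /= => /andP[? ?]; lra.
have midZ w : mid (N^-1 * w.1, N^-1 * w.2) = N^-1 * mid w.
  have Ni : 0 <= N^-1 by rewrite invr_ge0 ltW.
  rewrite /mid /= (support_homogeneous w _ Ni).
  have := support_homogeneous (- w.1, - w.2) _ Ni; rewrite /= !mulrN => ->.
  by field; rewrite gt_eqF.
have rotZ w : rot (N^-1 * w.1, N^-1 * w.2) = (N^-1 * (rot w).1, N^-1 * (rot w).2).
  by rewrite /rot /=; congr pair; ring.
exists (N^-1 * v.1, N^-1 * v.2); split.
  by rewrite /= !exprMn -mulrDr -N2 exprVn mulVf // expf_neq0 // gt_eqF.
rewrite !rotZ !midZ -mulrDr; congr (_ * _).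
by move: gt; rewrite /g -vE; lra.
Qed.

End Support.

Lemma inscribe K : complete K -> exists f, euclid_isometry f /\
  exists y0 y1 y2, inscribed (f @` K) y0 y1 y2.
Proof.
move=> cK; have [H HP] := support_function _ cK.
have [u [u1 conc]] := concurrent_midlines _ _ cK HP.
have s2 := sqr_sqrt3.
have s2' : s3 * s3 = 3 by rewrite -expr2.
have s0 : s3 != 0 by apply/eqP => h; move: s2; rewrite h expr0n /= => ?; lra.
have rot1 w : w.1 ^+ 2 + w.2 ^+ 2 = 1 -> (rot w).1 ^+ 2 + (rot w).2 ^+ 2 = 1.
  move=> <-; rewrite /rot /=.
  have -> : (w.1 / 2 - s3 / 2 * w.2) ^+ 2 + (s3 / 2 * w.1 + w.2 / 2) ^+ 2 =
    (1 + s3 ^+ 2) / 4 * (w.1 ^+ 2 + w.2 ^+ 2) by field.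
  by rewrite s2; field.
have wid w : w.1 ^+ 2 + w.2 ^+ 2 = 1 -> (H w - H (- w.1, - w.2)) / 2 = H w - 1 / 2.
  by move=> w1; rewrite (support_width _ _ cK HP) //; field.
have ru1 := rot1 _ u1; have rru1 := rot1 _ ru1.
rewrite !wid // in conc.
pose m0 := H u - 1 / 2; pose m2 := H (rot (rot u)) - 1 / 2.
(* The common point [c] of the midlines has coordinate [m0] along [u]. Its coordinate [be] along the
   normal of [u] is solved from the midline of [rot (rot u)], which is [- u / 2] plus [s3 / 2] times
   that normal. *)
pose be := (2 * m2 + m0) / s3.
have beE : s3 * be = 2 * m2 + m0 by rewrite /be mulrC divfK.
pose c1 := m0 * u.1 - be * u.2; pose c2 := m0 * u.2 + be * u.1.
(* Moves [c] to the origin and turns [u] into [(1, 0)]. *)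
pose f p : R * R := (u.1 * (p.1 - c1) + u.2 * (p.2 - c2),
                     - u.2 * (p.1 - c1) + u.1 * (p.2 - c2)).
have fdsq p q : dsq (f p) (f q) = dsq p q.
  transitivity ((u.1 ^+ 2 + u.2 ^+ 2) * dsq p q); last by rewrite u1 mul1r.
  by rewrite /dsq /f /=; ring.
(* [e] plays the role of a direction in the new frame, [w] of the same
   direction in the old one *)
have touch e w : e.1 ^+ 2 + e.2 ^+ 2 = 1 ->
    w = (e.1 * u.1 - e.2 * u.2, e.1 * u.2 + e.2 * u.1) ->
    w.1 * c1 + w.2 * c2 = H w - 1 / 2 -> exists y, touches (f @` K) e y.
  move=> e1 wE cw.
  have w1 : w.1 ^+ 2 + w.2 ^+ 2 = 1.
    transitivity ((e.1 ^+ 2 + e.2 ^+ 2) * (u.1 ^+ 2 + u.2 ^+ 2)).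
      by rewrite wE /=; ring.
    by rewrite e1 u1 mulr1.
  have [[p Kp pw] pmax] := HP w.
  have Kpw : K (p.1 - w.1, p.2 - w.2).
    by apply: complete_antipode => // q Kq; rewrite pw; exact: pmax.
  pose y := - e.2 * (f p).1 + e.1 * (f p).2.
  have ef : e.1 * (f p).1 + e.2 * (f p).2 = 1 / 2.
    have -> : e.1 * (f p).1 + e.2 * (f p).2 = dot w p - (w.1 * c1 + w.2 * c2).
      by rewrite wE /f /dot /=; ring.
    by rewrite pw cw; ring.
  have fp1 : (f p).1 = e.1 / 2 - y * e.2.
    transitivity ((f p).1 * (e.1 ^+ 2 + e.2 ^+ 2)); first by rewrite e1 mulr1.
    transitivity (e.1 * (e.1 * (f p).1 + e.2 * (f p).2) - y * e.2).
      by rewrite /y; ring.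
    by rewrite ef; field.
  have fp2 : (f p).2 = e.2 / 2 + y * e.1.
    transitivity ((f p).2 * (e.1 ^+ 2 + e.2 ^+ 2)); first by rewrite e1 mulr1.
    transitivity (e.2 * (e.1 * (f p).1 + e.2 * (f p).2) + y * e.1).
      by rewrite /y; ring.
    by rewrite ef; field.
  have fpw : f (p.1 - w.1, p.2 - w.2) = ((f p).1 - e.1, (f p).2 - e.2).
    transitivity ((f p).1 - e.1 * (u.1 ^+ 2 + u.2 ^+ 2),
                  (f p).2 - e.2 * (u.1 ^+ 2 + u.2 ^+ 2)); last by rewrite u1 !mulr1.
    by rewrite wE /f /=; congr pair; ring.
  exists y; split.
    by exists p => //; rewrite -fp1 -fp2 -surjective_pairing.
  exists (p.1 - w.1, p.2 - w.2) => //; rewrite fpw fp1 fp2.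
  by congr pair; field.
exists f; split.
  exists u.1, (- u.2), (- u.1 * c1 - u.2 * c2), (u.2 * c1 - u.1 * c2), false.
  by split=> [|p]; [rewrite sqrrN|rewrite /f; congr pair; ring].
have uE : u = (u.1, u.2) by exact: surjective_pairing.
have c_u : u.1 * c1 + u.2 * c2 = H u - 1 / 2.
  have -> : u.1 * c1 + u.2 * c2 = m0 * (u.1 ^+ 2 + u.2 ^+ 2) by rewrite /c1 /c2; ring.
  by rewrite u1 mulr1.
have c_perp : - u.2 * c1 + u.1 * c2 = be.
  have -> : - u.2 * c1 + u.1 * c2 = be * (u.1 ^+ 2 + u.2 ^+ 2) by rewrite /c1 /c2; ring.
  by rewrite u1 mulr1.
have c_rru : (rot (rot u)).1 * c1 + (rot (rot u)).2 * c2 = H (rot (rot u)) - 1 / 2.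
  have -> : (rot (rot u)).1 * c1 + (rot (rot u)).2 * c2 =
      (1 - s3 ^+ 2) / 4 * (u.1 * c1 + u.2 * c2) + s3 / 2 * (- u.2 * c1 + u.1 * c2).
    by rewrite /rot /=; field.
  by rewrite s2 c_u c_perp -/m0 -/m2; lra.
have c_ru : (rot u).1 * c1 + (rot u).2 * c2 = H (rot u) - 1 / 2.
  rewrite conc -c_rru -c_u.
  have -> : u.1 * c1 + u.2 * c2 + ((rot (rot u)).1 * c1 + (rot (rot u)).2 * c2) =
     (5 - s3 ^+ 2) / 4 * (u.1 * c1 + u.2 * c2) + s3 / 2 * (- u.2 * c1 + u.1 * c2).
    by rewrite /rot /=; field.
  by rewrite s2 /rot /=; field.
have e1 : (1 : R) ^+ 2 + 0 ^+ 2 = 1 by ring.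
have [|y0 t0] := touch (1, 0) u e1 _ c_u; first by rewrite {1}uE /=; congr pair; ring.
have [|y1 t1] := touch (rot (1, 0)) (rot u) (rot1 (1, 0) e1) _ c_ru.
  by rewrite /rot /=; congr pair; ring.
have [|y2 t2] := touch (rot (rot (1, 0))) (rot (rot u)) (rot1 _ (rot1 (1, 0) e1)) _ c_rru.
  by rewrite /rot /=; congr pair; field.
exists y0, y1, y2; split=> // _ _ [p Kp <-] [q Kq <-].
by rewrite fdsq; exact: cK.1.
Qed.

End InscribedHexagon.

(** * Placement in the cover *)

Section Placement.
Context {R : realType}.
Implicit Types (K U : set (R * R)) (p q z n w : R * R).

Local Notation s3 := (@sqrt3 R).

Definition avoids K n := forall p, K p -> dot n p <= 1 / 2.

Definition coverable U K := exists f, euclid_isometry f /\ f @` K `<=` U.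

Lemma unit_dot w p q : w.1 ^+ 2 + w.2 ^+ 2 = 1 -> dsq p q <= 1 ->
  dot w p - dot w q <= 1.
Proof.
move=> w1 pq; have : (dot w p - dot w q) ^+ 2 <= 1.
  apply: le_trans pq; rewrite -[leRHS]mul1r -w1 /dot /dsq.
  have := sqr_ge0 (w.1 * (p.2 - q.2) - w.2 * (p.1 - q.1)); lra.
nra.
Qed.

Lemma avoids_or_opp K n : unit_diam K -> n.1 ^+ 2 + n.2 ^+ 2 = 1 ->
  avoids K n \/ avoids K (- n.1, - n.2).
Proof.
move=> dK n1; have [h|h] := pselect (avoids K n); [by left|right=> q Kq].
apply: contrapT => /negP; rewrite -ltNge => hq; apply: h => p Kp.
by have := unit_dot n p q n1 (dK _ _ Kp Kq); move: hq; rewrite /dot /=; lra.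
Qed.

Lemma touches_opp K w y : touches K w y <-> touches K (- w.1, - w.2) (- y).
Proof.
by rewrite /touches /= !mulrNN !opprK; split=> -[].
Qed.

(** The facing contact point lies at height [- 1 / 2], and no point is more than 1 above it. Hence
    inscribed sets lie in the hexagon. *)
Lemma touches_avoids K w y : unit_diam K -> w.1 ^+ 2 + w.2 ^+ 2 = 1 ->
  touches K w y -> avoids K w.
Proof.
move=> dK w1 [_ Kq] p Kp; have := unit_dot w _ _ w1 (dK _ _ Kp Kq).
have -> : dot w (- w.1 / 2 - y * w.2, - w.2 / 2 + y * w.1) =
  - (w.1 ^+ 2 + w.2 ^+ 2) / 2 by rewrite /dot /=; field.
by rewrite w1; lra.
Qed.

Lemma isometry_comp (f g : R * R -> R * R) :
  euclid_isometry f -> euclid_isometry g -> euclid_isometry (f \o g).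
Proof.
move=> [c [s [t1 [t2 [r [cs fE]]]]]] [c' [s' [t1' [t2' [r' [cs' gE]]]]]].
have cs2 : (c * c' - s * s') ^+ 2 + (s * c' + c * s') ^+ 2 = 1.
  transitivity ((c ^+ 2 + s ^+ 2) * (c' ^+ 2 + s' ^+ 2)); first by ring.
  by rewrite cs cs' mulr1.
have cs3 : (c * c' + s * s') ^+ 2 + (s * c' - c * s') ^+ 2 = 1.
  transitivity ((c ^+ 2 + s ^+ 2) * (c' ^+ 2 + s' ^+ 2)); first by ring.
  by rewrite cs cs' mulr1.
case: r fE => fE.
  exists (c * c' + s * s'), (s * c' - c * s'), (c * t1' + s * t2' + t1),
    (s * t1' - c * t2' + t2), (~~ r'); split=> // p.
  by case: r' gE => gE /=; rewrite fE gE /=; congr pair; ring.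
exists (c * c' - s * s'), (s * c' + c * s'), (c * t1' - s * t2' + t1),
  (s * t1' + c * t2' + t2), r'; split=> // p.
by case: r' gE => gE /=; rewrite fE gE /=; congr pair; ring.
Qed.

Lemma coverable_image U K f : euclid_isometry f ->
  coverable U (f @` K) -> coverable U K.
Proof.
move=> fI [g [gI gU]]; exists (g \o f); split; first exact: isometry_comp.
by rewrite image_comp in gU.
Qed.

Lemma coverable_sub U K : K `<=` U -> coverable U K.
Proof.
move=> KU; exists id; split; last by rewrite image_id.
exists 1, 0, 0, 0, false; split=> [|p]; first by ring.
by rewrite [LHS]surjective_pairing; congr pair; ring.
Qed.

Lemma rot_isometry : euclid_isometry (@rot R).
Proof.
exists (1 / 2), (s3 / 2), 0, 0, false; split.
  by have := @sqr_sqrt3 R; lra.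
by move=> p; rewrite /rot; congr pair; ring.
Qed.

Lemma rot2E p : rot (rot p) = (- p.1 / 2 - s3 / 2 * p.2, s3 / 2 * p.1 - p.2 / 2).
Proof.
have e (x : R) : s3 * s3 * x = 3 * x by rewrite -expr2 sqr_sqrt3.
by have := e p.1; have := e p.2; rewrite /rot /= => e1 e2; congr pair; lra.
Qed.

Lemma rot3E p : rot (rot (rot p)) = (- p.1, - p.2).
Proof.
have e (x : R) : s3 * s3 * x = 3 * x by rewrite -expr2 sqr_sqrt3.
by have := e p.1; have := e p.2; rewrite rot2E /rot /= => e1 e2; congr pair; lra.
Qed.

Lemma dot_rot p q : dot (rot p) (rot q) = dot p q.
Proof.
transitivity ((1 + s3 ^+ 2) / 4 * dot p q); first by rewrite /dot /rot /=; field.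
by rewrite sqr_sqrt3; field.
Qed.

Lemma rot_norm1 w : w.1 ^+ 2 + w.2 ^+ 2 = 1 -> (rot w).1 ^+ 2 + (rot w).2 ^+ 2 = 1.
Proof. by move=> w1; have := dot_rot w w; rewrite /dot -!expr2 w1. Qed.

Lemma unit_diam_isometry K f : euclid_isometry f -> unit_diam K -> unit_diam (f @` K).
Proof.
move=> [c [s [t1 [t2 [r [cs fE]]]]]] dK _ _ [p Kp <-] [q Kq <-].
suff -> : dsq (f p) (f q) = dsq p q by exact: dK.
transitivity ((c ^+ 2 + s ^+ 2) * dsq p q); last by rewrite cs mul1r.
by case: r fE => fE; rewrite !fE /dsq /=; ring.
Qed.

Lemma avoids_rot K n : avoids K n -> avoids (@rot R @` K) (rot n).
Proof. by move=> h _ [p Kp <-]; rewrite dot_rot; exact: h. Qed.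

Lemma touches_rot K w y : touches K w y -> touches (@rot R @` K) (rot w) y.
Proof.
move=> [K1 K2]; split.
  exists (w.1 / 2 - y * w.2, w.2 / 2 + y * w.1) => //.
  by rewrite /rot /=; congr pair; field.
exists (- w.1 / 2 - y * w.2, - w.2 / 2 + y * w.1) => //.
by rewrite /rot /=; congr pair; field.
Qed.

(** The direction at 120 degrees moves to 180 degrees, opposite to [(1, 0)], so [y2] changes
    sign. *)
Lemma inscribed_rot K y0 y1 y2 : inscribed K y0 y1 y2 ->
  inscribed (@rot R @` K) (- y2) y0 y1.
Proof.
move=> [dK t0 t1 t2]; split.
- exact: unit_diam_isometry rot_isometry dK.
- have := touches_rot _ _ _ t2; rewrite rot3E /= => /touches_opp.
  by rewrite /= !opprK.
- exact: touches_rot.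
- exact: touches_rot.
Qed.

(* the reflection in the axis through the midpoints of the sides
   touched at [y2]; it exchanges the two neighbouring pairs of sides *)
Definition mirror p : R * R :=
  (- (1 / 2) * p.1 - s3 / 2 * p.2, - (s3 / 2) * p.1 + p.2 / 2).

Lemma mirror_isometry : euclid_isometry mirror.
Proof.
exists (- (1 / 2)), (- (s3 / 2)), 0, 0, true; split.
  by have := @sqr_sqrt3 R; lra.
by move=> p; rewrite /mirror; congr pair; ring.
Qed.

Lemma mirrorK p : mirror (mirror p) = p.
Proof.
have e (x : R) : s3 * s3 * x = 3 * x by rewrite -expr2 sqr_sqrt3.
rewrite [RHS]surjective_pairing /mirror /=.
by have := e p.1; have := e p.2 => e1 e2; congr pair; lra.
Qed.

Lemma dot_mirror p q : dot (mirror p) (mirror q) = dot p q.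
Proof.
transitivity ((1 + s3 ^+ 2) / 4 * dot p q); first by rewrite /dot /mirror /=; field.
by rewrite sqr_sqrt3; field.
Qed.

Lemma avoids_mirror K n : avoids K (mirror n) -> avoids (mirror @` K) n.
Proof. by move=> h _ [p Kp <-]; rewrite -[n]mirrorK dot_mirror; exact: h. Qed.

Lemma touches_mirror K w y : touches K w y -> touches (mirror @` K) (mirror w) (- y).
Proof.
move=> [K1 K2]; split.
  exists (w.1 / 2 - y * w.2, w.2 / 2 + y * w.1) => //.
  by rewrite /mirror /=; congr pair; field.
exists (- w.1 / 2 - y * w.2, - w.2 / 2 + y * w.1) => //.
by rewrite /mirror /=; congr pair; field.
Qed.

(** A reflection negates offsets; for [y0] and [y1], passing to the opposite direction negates them
    back. *)
Lemma inscribed_mirror K y0 y1 y2 : inscribed K y0 y1 y2 ->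
  inscribed (mirror @` K) y1 y0 (- y2).
Proof.
have e : s3 * s3 = 3 by rewrite -expr2 sqr_sqrt3.
move=> [dK t0 t1 t2]; split.
- exact: unit_diam_isometry mirror_isometry dK.
- apply/touches_opp; have := touches_mirror _ _ _ t1; congr touches.
  by rewrite /mirror /rot /=; congr pair; lra.
- apply/touches_opp; have := touches_mirror _ _ _ t0; congr touches.
  by rewrite /mirror /rot /=; congr pair; lra.
- have := touches_mirror _ _ _ t2; congr touches.
  by rewrite rot2E /mirror /=; congr pair; lra.
Qed.

End Placement.

(** * The polygon, and its sides as consequences of contacts and cuts *)

Section Cover.
Context {R : realType}.
Implicit Types (K U : set (R * R)) (p q z n w : R * R).

Local Notation s3 := (@sqrt3 R).

Fixpoint polygon (l : seq (R * R * R)) : set (R * R) :=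
  if l is (a, b, c) :: l' then [set z | a * z.1 + b * z.2 <= c] `&` polygon l'
  else setT.

Lemma polygon_cons a b c l z :
  polygon ((a, b, c) :: l) z <-> a * z.1 + b * z.2 <= c /\ polygon l z.
Proof. by []. Qed.

Lemma polygon_convex l : convex_set2 (polygon l).
Proof.
elim: l => [//|[[a b] c] l IH] x y [hx lx] [hy ly] t t01.
split; last exact: IH.
have /andP[t0 t1] := t01; rewrite /=.
have -> : a * ((1 - t) * x.1 + t * y.1) + b * ((1 - t) * x.2 + t * y.2) =
  (1 - t) * (a * x.1 + b * x.2) + t * (a * y.1 + b * y.2) by ring.
have -> : c = (1 - t) * c + t * c by ring.
by apply: lerD; apply: ler_wpM2l => //; lra.
Qed.

Definition dec (n : nat) : R := n%:R / 10000000%:R.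
Arguments dec n%_N.

Lemma dec_ge0 m : 0 <= dec m.
Proof. apply: divr_ge0; exact: ler0n. Qed.

(* cosine and sine of the tilt angle sigma, tan (sigma / 2) = 1 / 90 *)
Definition ctilt : R := 8099%:R / 8101%:R.
Definition stilt : R := 180%:R / 8101%:R.

Lemma tilt_norm1 : stilt ^+ 2 + ctilt ^+ 2 = 1.
Proof. by rewrite /stilt /ctilt; field. Qed.

(* [clear] is essential: [lra] would compare other [dec] atoms by unfolding them
   to unary numbers. *)
Ltac numeric sl su :=
  clear - sl su; rewrite /dec in sl su; rewrite ?/dec ?/ctilt ?/stilt; lra.

Lemma sqrt3_bounds : dec 17320508 <= s3 <= dec 17320509.
Proof.
have s0 := @sqrt3_ge0 R; have s2 := @sqr_sqrt3 R.
have l2 : dec 17320508 ^+ 2 <= 3 by rewrite /dec; lra.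
have u2 : 3 <= dec 17320509 ^+ 2 by rewrite /dec; lra.
have l0 := dec_ge0 17320508.
have u0 := dec_ge0 17320509.
have sqr_le (x y : R) : 0 <= x -> 0 <= y -> x ^+ 2 <= y ^+ 2 -> x <= y.
  by move=> x0 y0; rewrite ler_pXn2r.
apply/andP; split; apply: sqr_le.
- exact: l0.
- exact: s0.
- by rewrite s2; exact: l2.
- exact: s0.
- exact: u0.
- by rewrite s2; exact: u2.
Qed.

(** Says that tan sigma is less than tan 30 degrees. *)
Lemma tilt_lt : stilt * s3 < ctilt.
Proof.
have /andP[sl su] := sqrt3_bounds.
by numeric sl su.
Qed.

(** Says that tan (sigma / 2) is less than [2 - s3], the tangent of 15 degrees. *)
Lemma tilt_half_lt : 1 < stilt * (2 - s3) + ctilt.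
Proof.
have /andP[sl su] := sqrt3_bounds.
by numeric sl su.
Qed.

(* The six sides of the hexagon, the two tilted cuts, five tangents to each of
   the two unit arcs near the corner between directions 0 and -60 degrees,
   all rounded outwards. *)
Definition cover_sides : seq (R * R * R) := [::
   (1, 0, 1 / 2);
   (- 1, 0, 1 / 2);
   (- dec 5773503, 1, dec 5773503);
   (dec 5773503, 1, dec 5773503);
   (- dec 5773503, - 1, dec 5773503);
   (dec 5773503, - 1, dec 5773503);
   (- dec 222250, 1, dec 5001235);
   (- dec 16464463, - 1, dec 9631701);
   (dec 6159000, - 1, dec 5917370);
   (dec 6557000, - 1, dec 6075522);
   (dec 6971000, - 1, dec 6249856);
   (dec 7402000, - 1, dec 6441396);
   (dec 7851000, - 1, dec 6651187);
   (dec 373000000, - 1, dec 187973771);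
   (dec 186400000, - 1, dec 94807794);
   (dec 124100000, - 1, dec 63791995);
   (dec 92900000, - 1, dec 48326410);
   (dec 74200000, - 1, dec 39110569)].

Definition cover : set (R * R) := polygon cover_sides.

(** Here [r] is the norm of the normal [(b, -1)], rounded up, so the half-plane contains the unit
    disc around [q]. *)
Lemma tangent_side z q b r c : dsq z q <= 1 -> 0 <= r -> 1 + b ^+ 2 <= r ^+ 2 ->
  b * q.1 - q.2 + r <= c -> b * z.1 + - 1 * z.2 <= c.
Proof.
move=> zq r0 br qc; suff : b * (z.1 - q.1) - (z.2 - q.2) <= r by lra.
have : (b * (z.1 - q.1) - (z.2 - q.2)) ^+ 2 <= r ^+ 2.
  apply: le_trans br; apply: (@le_trans _ _ ((1 + b ^+ 2) * dsq z q)).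
    rewrite /dsq; have := sqr_ge0 (b * (z.2 - q.2) + (z.1 - q.1)); lra.
  by rewrite ler_piMr //; nra.
nra.
Qed.

(** Passes from an exact side to its rounded form, scaled by [k]; the rounding error
    [(k * b - A) * x] is controlled by [x] lying between [- 1 / 2] and [1 / 2]. *)
Lemma outer_side (A B k b e c x y : R) : -1 * x + 0 * y <= 1 / 2 ->
  1 * x + 0 * y <= 1 / 2 -> A * x + B * y <= 1 / 2 -> 0 < k -> B = k * e ->
  1 / 2 - k * c + (k * b - A) / 2 <= 0 -> 1 / 2 - k * c - (k * b - A) / 2 <= 0 ->
  b * x + e * y <= c.
Proof.
move=> x1 x2 h k0 BE h1 h2; rewrite BE in h.
suff : k * (b * x + e * y - c) <= 0 by rewrite pmulr_rle0 // subr_le0.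
have : (k * b - A) * x <= `|k * b - A| * (1 / 2).
  rewrite (le_trans (ler_norm _)) // normrM ler_wpM2l // ler_norml.
  by apply/andP; split; lra.
by case: (ger0P (k * b - A)); lra.
Qed.

(** The side follows from a nonnegative combination of the cut [P * x - Q * y <= 1 / 2] and
    [x <= 1 / 2]. *)
Lemma corner_side (P Q b c x y : R) : 1 * x + 0 * y <= 1 / 2 ->
  P * x - Q * y <= 1 / 2 -> 0 < Q -> P <= Q * b ->
  1 / 2 + (Q * b - P) / 2 <= Q * c -> b * x + - 1 * y <= c.
Proof.
move=> x1 h Q0 PQ hc.
suff : Q * (b * x + - 1 * y - c) <= 0 by rewrite pmulr_rle0 // subr_le0.
have : (Q * b - P) * x <= (Q * b - P) * (1 / 2) by apply: ler_wpM2l; lra.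
lra.
Qed.

(** The disc is centred at the contact point at 120 degrees. Since [1 <= b * s3], its tangent lies
    farthest out at the extreme offset [y']. *)
Lemma contact_side z y y' b r c :
  dsq z (- (1 / 4) - s3 / 2 * y, s3 / 4 - y / 2) <= 1 -> y' <= y ->
  1 <= b * s3 -> 0 <= r -> 1 + b ^+ 2 <= r ^+ 2 ->
  - (b / 4) - s3 / 4 + y' * (1 - b * s3) / 2 + r <= c ->
  b * z.1 + - 1 * z.2 <= c.
Proof.
move=> q2 yy bs r0 br hc; apply: tangent_side q2 r0 br _.
have : 0 <= (b * s3 - 1) * (y - y') by rewrite mulr_ge0 ?subr_ge0.
by rewrite /=; lra.
Qed.

Lemma dot_opp_rot S C z : dot (- (rot (S, C)).1, - (rot (S, C)).2) z =
  (s3 / 2 * C - S / 2) * z.1 - (s3 / 2 * S + C / 2) * z.2.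
Proof. by rewrite /dot /rot /=; ring. Qed.

(** Tangents around the contact point at 180 degrees, for the untilted extreme offset [s3 / 2 - 1],
    which is - tan (15 deg) / 2. In the other case the cut at the corner at -30 degrees is already
    stronger. *)
Lemma edge_side z y0 P Q b r c : 1 * z.1 + 0 * z.2 <= 1 / 2 ->
  (dsq z (- 1 / 2, y0) <= 1 /\ s3 / 2 - 1 <= y0) \/ P * z.1 - Q * z.2 <= 1 / 2 ->
  0 <= r -> 1 + b ^+ 2 <= r ^+ 2 -> - (b / 2) - (s3 / 2 - 1) + r <= c ->
  0 < Q -> P <= Q * b -> 1 / 2 + (Q * b - P) / 2 <= Q * c ->
  b * z.1 + - 1 * z.2 <= c.
Proof.
move=> xr [[q3 y0ge]|hA] r0 br hc Q0 PQ hc'; last exact: corner_side xr hA Q0 PQ hc'.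
by apply: tangent_side q3 r0 br _; rewrite /=; lra.
Qed.

(** The contact point at 120 degrees obeys the cut at 90 degrees, whose left side decreases in
    [y]. *)
Lemma cut_contact (S C y y' : R) : 0 < C - S * s3 ->
  - S * (- (1 / 4) - s3 / 2 * y) + C * (s3 / 4 - y / 2) <= 1 / 2 ->
  1 / 2 <= S / 4 + S * s3 / 2 * y' + C * s3 / 4 - C / 2 * y' -> y' <= y.
Proof.
move=> CS h h'; rewrite leNgt; apply/negP => lty.
have : 0 < (C - S * s3) * (y' - y) by apply: mulr_gt0; rewrite ?subr_gt0 // -subr_gt0.
lra.
Qed.

Lemma inscribed_sub_cover K y0 y1 y2 : inscribed K y0 y1 y2 ->
  avoids K (- stilt, ctilt) -> avoids K (rot (rot (- stilt, ctilt))) ->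
  s3 / 2 - 1 <= y0 \/
    avoids K (- (rot (stilt, ctilt)).1, - (rot (stilt, ctilt)).2) ->
  K `<=` cover.
Proof.
move=> ins aC aE aA z Kz.
have [dK t0 t1 t2] := ins.
have /andP[sl su] := sqrt3_bounds.
have e0 : (1 : R) ^+ 2 + 0 ^+ 2 = 1 by ring.
have e1 := rot_norm1 (1, 0) e0.
have e2 := rot_norm1 _ e1.
have opp1 w : w.1 ^+ 2 + w.2 ^+ 2 = 1 -> (- w.1) ^+ 2 + (- w.2) ^+ 2 = 1.
  by rewrite !sqrrN.
have h0 := touches_avoids _ (1, 0) _ dK e0 t0 _ Kz.
have h3 := touches_avoids _ (_, _) _ dK (opp1 (1, 0) e0)
  ((touches_opp _ _ _).1 t0) _ Kz.
have h1 := touches_avoids _ _ _ dK e1 t1 _ Kz.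
have h4 := touches_avoids _ (_, _) _ dK (opp1 _ e1) ((touches_opp _ _ _).1 t1) _ Kz.
have h2 := touches_avoids _ _ _ dK e2 t2 _ Kz.
have h5 := touches_avoids _ (_, _) _ dK (opp1 _ e2) ((touches_opp _ _ _).1 t2) _ Kz.
have hC := aC _ Kz; have hE := aE _ Kz.
have q3 : dsq z (- 1 / 2, y0) <= 1.
  have := t0.2; rewrite /= => Kq.
  by have := dK _ _ Kz Kq; rewrite mulr0 subr0 oppr0 mul0r add0r mulr1.
have q2 : dsq z (- (1 / 4) - s3 / 2 * y2, s3 / 4 - y2 / 2) <= 1.
  have := t2.1; rewrite rot2E /= => Kq.
  by have := dK _ _ Kz Kq; congr (dsq _ _ <= _); congr pair; field.
(* - tan (15 deg - sigma / 2) / 2, rounded down *)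
have y2ge : - dec 1280379 <= y2.
  apply: (cut_contact stilt ctilt).
  - numeric sl su.
  - by have := aC _ t2.1; rewrite rot2E /dot /=; congr (_ <= _); field.
  - numeric sl su.
have xr : 1 * z.1 + 0 * z.2 <= 1 / 2 by [].
have xl : - 1 * z.1 + 0 * z.2 <= 1 / 2.
  by move: h3; rewrite /dot /= oppr0.
rewrite rot2E /dot /= in h2; rewrite /rot /dot /= in h1.
rewrite rot2E /dot /= in h5; rewrite /rot /dot /= in h4.
rewrite rot2E /dot /= in hE; rewrite /dot /= in hC.
have arcF b r c := contact_side _ _ _ b r c q2 y2ge.
have hA : (dsq z (- 1 / 2, y0) <= 1 /\ s3 / 2 - 1 <= y0) \/
    (s3 / 2 * ctilt - stilt / 2) * z.1 - (s3 / 2 * stilt + ctilt / 2) * z.2 <= 1 / 2.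
  case: aA => [y0ge|/(_ _ Kz)]; first by left.
  by rewrite dot_opp_rot; right.
have arcA b r c := edge_side z y0 _ _ b r c xr hA.
apply/polygon_cons; split; first exact: xr.
apply/polygon_cons; split; first exact: xl.
apply/polygon_cons; split.
  apply: (outer_side _ _ (s3 / 2) _ _ _ _ _ xl xr h2);
    numeric sl su.
apply/polygon_cons; split.
  apply: (outer_side _ _ (s3 / 2) _ _ _ _ _ xl xr h1);
    numeric sl su.
apply/polygon_cons; split.
  apply: (outer_side _ _ (s3 / 2) _ _ _ _ _ xl xr h4);
    numeric sl su.
apply/polygon_cons; split.
  apply: (outer_side _ _ (s3 / 2) _ _ _ _ _ xl xr h5);
    numeric sl su.
apply/polygon_cons; split.
  apply: (outer_side _ _ ctilt _ _ _ _ _ xl xr hC);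
    numeric sl su.
apply/polygon_cons; split.
  apply: (outer_side _ _ (s3 / 2 * stilt + ctilt / 2) _ _ _ _ _ xl xr hE);
    numeric sl su.
apply/polygon_cons; split.
  apply: (arcF _ (dec 11744501)); [|exact: dec_ge0| |];
    numeric sl su.
apply/polygon_cons; split.
  apply: (arcF _ (dec 11958021)); [|exact: dec_ge0| |];
    numeric sl su.
apply/polygon_cons; split.
  apply: (arcF _ (dec 12189949)); [|exact: dec_ge0| |];
    numeric sl su.
apply/polygon_cons; split.
  apply: (arcF _ (dec 12441448)); [|exact: dec_ge0| |];
    numeric sl su.
apply/polygon_cons; split.
  apply: (arcF _ (dec 12713702)); [|exact: dec_ge0| |];
    numeric sl su.
apply/polygon_cons; split.
  apply: (arcA _ (dec 373134025)); [exact: dec_ge0| | | | |];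
    numeric sl su.
apply/polygon_cons; split.
  apply: (arcA _ (dec 186668048)); [exact: dec_ge0| | | | |];
    numeric sl su.
apply/polygon_cons; split.
  apply: (arcA _ (dec 124502249)); [exact: dec_ge0| | | | |];
    numeric sl su.
apply/polygon_cons; split.
  apply: (arcA _ (dec 93436664)); [exact: dec_ge0| | | | |];
    numeric sl su.
apply/polygon_cons; split.
  apply: (arcA _ (dec 74870823)); [exact: dec_ge0| | | | |];
    numeric sl su.
by [].
Qed.

End Cover.

(** * Choice of corners and universality *)

Section Covering.
Context {R : realType}.
Implicit Types (K : set (R * R)).

Local Notation s3 := (@sqrt3 R).
Local Notation S := (@stilt R).
Local Notation C := (@ctilt R).

(** A low contact point at 180 degrees lies in the corner at 210 degrees for the tilt - sigma: the
    dot product decreases in [y], and at [s3 / 2 - 1] it equals [(a * (2 - s3) + b) / 2]. *)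
Lemma low_contact (a b y : R) : a * s3 < b -> 1 < a * (2 - s3) + b ->
  y < s3 / 2 - 1 ->
  1 / 2 < dot (- a / 2 - s3 / 2 * b, s3 / 2 * a - b / 2) (- 1 / 2 - y * 0, - 0 / 2 + y * 1).
Proof.
move=> ab h yl; have : 0 < (b - a * s3) * (s3 / 2 - 1 - y).
  by apply: mulr_gt0; rewrite subr_gt0.
have : a * (s3 * s3) = a * 3 by rewrite -expr2 sqr_sqrt3.
by rewrite /dot /=; lra.
Qed.

(* the contact points at 180 and 60 degrees are at distance at most 1 *)
Lemma contact_trade K y0 y1 y2 : inscribed K y0 y1 y2 ->
  y0 < s3 / 2 - 1 -> s3 / 2 - 1 <= y1.
Proof.
move=> [dK t0 t1 _] y0lt; have s2 := @sqr_sqrt3 R; have s0 := @sqrt3_ge0 R.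
have d : dsq (1 / 4 - y1 * (s3 / 2), s3 / 4 + y1 / 2) (- 1 / 2, y0) <= 1.
  have := dK _ _ t1.1 t0.2; rewrite /rot /=.
  by congr (dsq _ _ <= _); congr pair; field.
(* The squared distance in [d] exceeds this square by 3/4 of [(y1 - y0) ^+ 2]; the bound gives
   [s3 - 2 <= y0 + y1]. *)
have : (s3 / 2 - (y0 + y1) / 2) ^+ 2 <= 1.
  have := sqr_ge0 (y1 - y0); move: d; rewrite /dsq /=.
  have : s3 ^+ 2 * y1 ^+ 2 = 3 * y1 ^+ 2 by rewrite s2.
  lra.
nra.
Qed.

Lemma mirror_tilt (a b : R) : mirror (- a, b) = rot (a, b).
Proof. by rewrite /mirror /rot /=; congr pair; field. Qed.

Lemma mirror_rot2_tilt (a b : R) :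
  mirror (rot (rot (- a, b))) = (- (rot (rot (a, b))).1, - (rot (rot (a, b))).2).
Proof.
have e (x : R) : s3 * s3 * x = 3 * x by rewrite -expr2 sqr_sqrt3.
by rewrite !rot2E /mirror /=; have := e a; have := e b => e1 e2; congr pair; lra.
Qed.

(* A set avoiding the corners at 90 and 210 degrees is placed directly, or, when
   the contact point at 180 degrees is too low, after the reflection [mirror],
   unless the opposite tilt avoids the corner at -30 degrees. *)
Lemma coverable_avoiding K y0 y1 y2 : inscribed K y0 y1 y2 ->
  avoids K (- S, C) -> avoids K (rot (rot (- S, C))) -> coverable cover K.
Proof.
move=> ins aC aE; have [dK t0 t1 _] := ins.
have direct : s3 / 2 - 1 <= y0 \/
    avoids K (- (rot (S, C)).1, - (rot (S, C)).2) -> coverable cover K.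
  by move=> h; apply: coverable_sub; exact: inscribed_sub_cover ins aC aE h.
have [y0ge|y0lt] := lerP (s3 / 2 - 1) y0; first by apply: direct; left.
have n1 : (S, C).1 ^+ 2 + (S, C).2 ^+ 2 = 1 by exact: tilt_norm1.
have [aD|aA] := avoids_or_opp K _ dK (rot_norm1 _ n1); last by apply: direct; right.
(* The low contact point occupies the corner at 210 degrees - sigma, so the one at 30 degrees -
   sigma is avoided. *)
have [aE'|aB] := avoids_or_opp K _ dK (rot_norm1 _ (rot_norm1 _ n1)).
  have := low_contact _ _ _ (@tilt_lt R) (@tilt_half_lt R) y0lt.
  by rewrite ltNge; have := aE' _ t0.2; rewrite rot2E => ->.
(* [mirror] sends an angle theta to 240 degrees - theta, hence the avoided corners at 150 - sigma
   and 30 - sigma to 90 + sigma and 210 + sigma. *)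
apply: (coverable_image _ _ _ mirror_isometry).
have ins' := inscribed_mirror _ _ _ _ ins.
apply: coverable_sub; apply: inscribed_sub_cover ins' _ _ _.
- by apply: avoids_mirror; rewrite mirror_tilt.
- by apply: avoids_mirror; rewrite mirror_rot2_tilt.
by left; exact: contact_trade ins y0lt.
Qed.

Lemma coverable_rot K : coverable cover (@rot R @` K) -> coverable cover K.
Proof. exact: coverable_image rot_isometry. Qed.

Lemma coverable_inscribed K y0 y1 y2 : inscribed K y0 y1 y2 -> coverable cover K.
Proof.
move=> ins; have [dK _ _ _] := ins.
pose n : R * R := (- S, C).
have n1 : n.1 ^+ 2 + n.2 ^+ 2 = 1 by rewrite /n /= sqrrN tilt_norm1.
have i1 := inscribed_rot _ _ _ _ ins; have i2 := inscribed_rot _ _ _ _ i1.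
have i3 := inscribed_rot _ _ _ _ i2; have i4 := inscribed_rot _ _ _ _ i3.
have i5 := inscribed_rot _ _ _ _ i4.
have r6 m : rot (rot (rot (rot (rot (rot m))))) = m :> R * R.
  by rewrite !rot3E /= !opprK -surjective_pairing.
have r := @avoids_rot R.
(* The digit k in these names stands for the corner at 60 k - 30 degrees, tilted by sigma. Any
   choice of one corner from each opposite pair contains two that are two apart; rotations bring
   them to 2 and 4. *)
have := avoids_or_opp _ _ dK n1; rewrite -rot3E => a25.
have := avoids_or_opp _ _ dK (rot_norm1 _ n1); rewrite -rot3E => a30.
have := avoids_or_opp _ _ dK (rot_norm1 _ (rot_norm1 _ n1)); rewrite -rot3E => a41.
case: a25 => [a2|a5]; case: a30 => [a3|a0]; case: a41 => [a4|a1].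
- exact: coverable_avoiding ins a2 a4.
- apply: coverable_rot; apply: coverable_avoiding i1 _ _; last exact: r a3.
  by have := r _ _ a1; rewrite r6.
- exact: coverable_avoiding ins a2 a4.
- do 2 apply: coverable_rot; apply: coverable_avoiding i2 _ _; last exact/r/r/a2.
  by have := r _ _ (r _ _ a0); rewrite r6.
- do 5 apply: coverable_rot; apply: coverable_avoiding i5 _ _.
    by have := r _ _ (r _ _ (r _ _ (r _ _ (r _ _ a3)))); rewrite r6.
  by have := r _ _ (r _ _ (r _ _ (r _ _ (r _ _ a5)))); rewrite r6.
- do 3 apply: coverable_rot; apply: coverable_avoiding i3 _ _.
    by have := r _ _ (r _ _ (r _ _ a5)); rewrite r6.
  by have := r _ _ (r _ _ (r _ _ a1)); rewrite r6.
- do 4 apply: coverable_rot; apply: coverable_avoiding i4 _ _.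
    by have := r _ _ (r _ _ (r _ _ (r _ _ a4))); rewrite r6.
  by have := r _ _ (r _ _ (r _ _ (r _ _ a0))); rewrite r6.
- do 3 apply: coverable_rot; apply: coverable_avoiding i3 _ _.
    by have := r _ _ (r _ _ (r _ _ a5)); rewrite r6.
  by have := r _ _ (r _ _ (r _ _ a1)); rewrite r6.
Qed.

Lemma cover_universal : universal_covering (@cover R).
Proof.
split; first exact: polygon_convex.
move=> A /diam_unit /unit_diam_complete [K [AK cK]].
have [f [fI [y0 [y1 [y2 /coverable_inscribed]]]]] := inscribe _ cK.
move=> /(coverable_image _ _ _ fI) [g [gI gK]].
exists g; split=> // z [p Ap <-]; apply: gK; exists p => //; exact: AK.
Qed.

End Covering.

(** * Area *)

Section Area.
Context {R : realType}.
Implicit Types (A : set (R * R)).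

Lemma measurable_halfplane (a b c : R) :
  measurable [set z : R * R | a * z.1 + b * z.2 <= c].
Proof.
have -> : [set z : R * R | a * z.1 + b * z.2 <= c] =
    setT `&` (fun z : R * R => a * z.1 + b * z.2) @^-1` [set` `]-oo, c]].
  by rewrite setTI; apply/seteqP; split=> z /=; rewrite in_itv.
have mf : measurable_fun setT (fun z : R * R => a * z.1 + b * z.2).
  apply: measurable_funD; apply: measurable_funM.
  - exact: measurable_cst.
  - exact: measurable_fst.
  - exact: measurable_cst.
  - exact: measurable_snd.
by apply: mf => //; exact: measurable_itv.
Qed.

Lemma measurable_polygon l : measurable (@polygon R l).
Proof.
elim: l => [|[[a b] c] l IH] /=; first exact: measurableT.
by apply: measurableI => //; exact: measurable_halfplane.
Qed.

Lemma integral_affine (x0 x1 a b : R) : x0 < x1 ->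
  (\int[lebesgue_measure]_(x in `[x0, x1]) (a + b * x)%:E =
   (a * (x1 - x0) + b * (x1 ^+ 2 - x0 ^+ 2) / 2)%:E)%E.
Proof.
move=> x01.
have drv (x : R) : is_derive x (1 : R) (fun y : R => a * y + b / 2 * y ^+ 2) (a + b * x).
  by apply: is_derive_eq; rewrite /GRing.scale /=; field.
pose F (y : R) := a * y + b / 2 * y ^+ 2.
transitivity ((F x1)%:E - (F x0)%:E)%E; last by rewrite -EFinB /F; congr EFin; field.
apply: continuous_FTC2 => //.
- apply: continuous_subspaceT => x.
  apply: (@continuousD _ _ _ (fun=> a) (fun y : R => b * y)).
    exact: cvg_cst.
  by apply: (@continuousM _ _ (fun=> b) id); [exact: cvg_cst|exact: cvg_id].
- have cF : continuous (fun y : R => a * y + b / 2 * y ^+ 2).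
    move=> x; apply: differentiable_continuous; apply/derivable1_diffP.
    by have [] := drv x.
  split.
  + by move=> x _; have [] := drv x.
  + exact: cvg_at_right_filter (cF _).
  + exact: cvg_at_left_filter (cF _).
- by move=> x _; rewrite derive1E; have [_ ->] := drv x.
Qed.

(** The area is the integral of the lengths of vertical sections, each lying in an interval of
    affine length. *)
Lemma area_trapezoid A (x0 x1 a b c d : R) : measurable A -> x0 < x1 ->
  a + b * x0 <= c + d * x0 -> a + b * x1 <= c + d * x1 ->
  (forall z, A z -> [/\ x0 <= z.1, z.1 <= x1, a + b * z.1 <= z.2 & z.2 <= c + d * z.1]) ->
  (area A <= ((c - a) * (x1 - x0) + (d - b) * (x1 ^+ 2 - x0 ^+ 2) / 2)%:E)%E.
Proof.
move=> mA x01 h0 h1 AT; rewrite -integral_affine // integral_mkcond.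
rewrite /area /product_measure1; apply: ge0_le_integral => //.
- exact: measurable_fun_xsection.
- apply/measurable_restrict => //; rewrite ?setTI.
  apply: measurableT_comp => //; apply: measurable_funTS.
  by apply: measurable_funD => //; apply: measurable_funM.
move=> x _ /=; rewrite patchE; case: ifPn => [|xn].
  rewrite inE /= in_itv /= => /andP[x0x xx1].
  have lu : a + b * x <= c + d * x.
    have : (x1 - x) * (a + b * x0) <= (x1 - x) * (c + d * x0).
      by apply: ler_wpM2l => //; lra.
    have : (x - x0) * (a + b * x1) <= (x - x0) * (c + d * x1).
      by apply: ler_wpM2l => //; lra.
    move=> e1 e2; have : (x1 - x0) * (a + b * x) <= (x1 - x0) * (c + d * x) by lra.
    by rewrite ler_pM2l // subr_gt0.
  apply: (@le_trans _ _ (lebesgue_measure [set` `[a + b * x, c + d * x]])).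
    apply: le_measure; rewrite ?inE.
    - exact: measurable_xsection.
    - exact: measurable_itv.
    - move=> y; rewrite /xsection /= inE => /AT[_ _ /= l u].
      by rewrite in_itv /= l u.
  rewrite lebesgue_measure_itv /= lte_fin; case: ifPn => _.
    by rewrite -EFinB lee_fin; lra.
  by rewrite lee_fin; lra.
have -> : xsection A x = set0.
  apply/seteqP; split=> y //; rewrite /xsection /= inE => /AT[/= x0x xx1 _ _].
  by move: xn; rewrite notin_setE /= in_itv /= x0x xx1.
by rewrite measure0.
Qed.

Definition right_of (x : R) : set (R * R) := [set z | x <= z.1].

Lemma measurable_right_of (x : R) : measurable (right_of x).
Proof.
have -> : right_of x = [set z | - 1 * z.1 + 0 * z.2 <= - x].
  by apply/seteqP; split=> z; rewrite /right_of /=; lra.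
exact: measurable_halfplane.
Qed.

(** Adds one trapezoid on the left to a bound [t] for the part right of [x1]. *)
Lemma area_slab A (x0 x1 a b c d t u : R) : measurable A -> x0 < x1 ->
  a + b * x0 <= c + d * x0 -> a + b * x1 <= c + d * x1 ->
  (forall z, A z -> a + b * z.1 <= z.2 /\ z.2 <= c + d * z.1) ->
  (area (A `&` right_of x1) <= t%:E)%E ->
  (c - a) * (x1 - x0) + (d - b) * (x1 ^+ 2 - x0 ^+ 2) / 2 + t <= u ->
  (area (A `&` right_of x0) <= u%:E)%E.
Proof.
move=> mA x01 h0 h1 AT At tu.
have mR := measurable_right_of.
have mL x : measurable [set z : R * R | z.1 <= x].
  have -> : [set z : R * R | z.1 <= x] = [set z | 1 * z.1 + 0 * z.2 <= x].
    by apply/seteqP; split=> z /=; lra.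
  exact: measurable_halfplane.
pose B := A `&` (right_of x0 `&` [set z | z.1 <= x1]).
have mB : measurable B by apply: measurableI => //; exact: measurableI.
have mC : measurable (A `&` right_of x1) by exact: measurableI.
have sub : A `&` right_of x0 `<=` B `|` (A `&` right_of x1).
  move=> z [Az /= x0z]; case: (lerP z.1 x1) => [zx1|/ltW]; [by left; split|by right].
apply: (@le_trans _ _ (area (B `|` (A `&` right_of x1)))).
  rewrite /area; apply: le_measure => //; rewrite inE.
    by apply: measurableI => //; exact: mR.
  exact: measurableU.
apply: (@le_trans _ _ (area B + area (A `&` right_of x1))%E).
  by rewrite /area; apply: measureU2.
apply: (@le_trans _ _ (((c - a) * (x1 - x0) + (d - b) * (x1 ^+ 2 - x0 ^+ 2) / 2)%:E
  + t%:E)%E); last by rewrite -EFinD lee_fin.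
apply: leeD => //; apply: area_trapezoid => // z [Az [/= x0z zx1]].
by have [] := AT _ Az.
Qed.

End Area.

(** * Area of the polygon, slab by slab *)

Section CoverArea.
Context {R : realType}.

Implicit Types (l : seq (R * R * R)) (z : R * R).

Lemma polygon_nth l z k : polygon l z -> (k < size l)%N ->
  let s := nth (0, 0, 0) l k in s.1.1 * z.1 + s.1.2 * z.2 <= s.2.
Proof.
by elim: l k => [|[[a b] c] l IH] [|k] //= [h hl] kl //; exact: IH hl kl.
Qed.

(** Side [i] bounds the polygon from below and side [j] from above. *)
Lemma slab_sides l i j (a b c d : R) :
  nth (0, 0, 0) l i = (b, - 1, a) -> nth (0, 0, 0) l j = (d, 1, c) ->
  (i < size l)%N -> (j < size l)%N ->
  forall z, polygon l z -> - a + b * z.1 <= z.2 /\ z.2 <= c + - d * z.1.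
Proof.
move=> li lj il jl z lz; have := polygon_nth l z i lz il.
have := polygon_nth l z j lz jl; rewrite li lj /= => h1 h2; split; lra.
Qed.

Lemma polygon_slab l i j (x0 x1 a b c d t u : R) :
  nth (0, 0, 0) l i = (b, - 1, a) -> nth (0, 0, 0) l j = (d, 1, c) ->
  (i < size l)%N -> (j < size l)%N -> x0 < x1 ->
  - a + b * x0 <= c + - d * x0 -> - a + b * x1 <= c + - d * x1 ->
  (c - - a) * (x1 - x0) + (- d - b) * (x1 ^+ 2 - x0 ^+ 2) / 2 + t <= u ->
  (area (polygon l `&` right_of x1) <= t%:E)%E ->
  (area (polygon l `&` right_of x0) <= u%:E)%E.
Proof.
move=> li lj il jl x01 h0 h1 tu ht.
apply: area_slab h0 h1 _ ht tu => //; first exact: measurable_polygon.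
exact: slab_sides li lj il jl.
Qed.

Lemma polygon_last_slab l i j k (x0 x1 a b c d u : R) :
  nth (0, 0, 0) l i = (b, - 1, a) -> nth (0, 0, 0) l j = (d, 1, c) ->
  nth (0, 0, 0) l k = (1, 0, x1) ->
  (i < size l)%N -> (j < size l)%N -> (k < size l)%N -> x0 < x1 ->
  - a + b * x0 <= c + - d * x0 -> - a + b * x1 <= c + - d * x1 ->
  (c - - a) * (x1 - x0) + (- d - b) * (x1 ^+ 2 - x0 ^+ 2) / 2 <= u ->
  (area (polygon l `&` right_of x0) <= u%:E)%E.
Proof.
move=> li lj lk il jl kl x01 h0 h1 hu; rewrite -lee_fin in hu.
apply: le_trans hu; apply: area_trapezoid => //.
  apply: measurableI; [exact: measurable_polygon|exact: measurable_right_of].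
move=> z [lz x0z]; have [lo up] := slab_sides l i j a b c d li lj il jl z lz.
have := polygon_nth l z k lz kl; rewrite lk /= => xz; split=> //; lra.
Qed.

(* The abscissas are those of the vertices; the other decimals bound the area to
   the right of them. *)
Lemma area_cover : (area (@cover R) <= (8441153%:R / 10000000%:R : R)%:E)%E.
Proof.
have -> : @cover R = cover `&` right_of (- dec 5000000).
  apply/seteqP; split=> [z cz|z []//]; split=> //.
  have : - 1 * z.1 + 0 * z.2 <= 1 / 2 by case: cz => _ [].
  by rewrite /right_of /= /dec => h; lra.
rewrite /cover.
(* From left to right, the lower boundary follows the cut 7, the hexagon sides 4 and 5, the tangents
   8 to 12 of one arc, then 17 down to 13 of the other; the upper one follows side 2, the cut 6 and
   side 3. *)
apply: (polygon_slab cover_sides 7 2 _ (- dec 3608850) _ _ _ _ (dec 762967854 / 100)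
  _ erefl erefl isT isT).
1-4: by clear; rewrite /dec; lra.
apply: (polygon_slab cover_sides 4 2 _ (- dec 1391160) _ _ _ _ (dec 570910384 / 100)
  _ erefl erefl isT isT).
1-4: by clear; rewrite /dec; lra.
apply: (polygon_slab cover_sides 4 6 _ (dec 0) _ _ _ _ (dec 426818407 / 100)
  _ erefl erefl isT isT).
1-4: by clear; rewrite /dec; lra.
apply: (polygon_slab cover_sides 5 6 _ (dec 1288020) _ _ _ _ (dec 292642378 / 100)
  _ erefl erefl isT isT).
1-4: by clear; rewrite /dec; lra.
apply: (polygon_slab cover_sides 5 3 _ (dec 3731980) _ _ _ _ (dec 81271426 / 100)
  _ erefl erefl isT isT).
1-4: by clear; rewrite /dec; lra.
apply: (polygon_slab cover_sides 8 3 _ (dec 3973660) _ _ _ _ (dec 64127868 / 100)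
  _ erefl erefl isT isT).
1-4: by clear; rewrite /dec; lra.
apply: (polygon_slab cover_sides 9 3 _ (dec 4210960) _ _ _ _ (dec 47984346 / 100)
  _ erefl erefl isT isT).
1-4: by clear; rewrite /dec; lra.
apply: (polygon_slab cover_sides 10 3 _ (dec 4444080) _ _ _ _ (dec 32812547 / 100)
  _ erefl erefl isT isT).
1-4: by clear; rewrite /dec; lra.
apply: (polygon_slab cover_sides 11 3 _ (dec 4672400) _ _ _ _ (dec 18635727 / 100)
  _ erefl erefl isT isT).
1-4: by clear; rewrite /dec; lra.
apply: (polygon_slab cover_sides 12 3 _ (dec 4892210) _ _ _ _ (dec 5647072 / 100)
  _ erefl erefl isT isT).
1-4: by clear; rewrite /dec; lra.
apply: (polygon_slab cover_sides 17 3 _ (dec 4928250) _ _ _ _ (dec 3623338 / 100)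
  _ erefl erefl isT isT).
1-4: by clear; rewrite /dec; lra.
apply: (polygon_slab cover_sides 16 3 _ (dec 4956910) _ _ _ _ (dec 2095833 / 100)
  _ erefl erefl isT isT).
1-4: by clear; rewrite /dec; lra.
apply: (polygon_slab cover_sides 15 3 _ (dec 4978450) _ _ _ _ (dec 1008386 / 100)
  _ erefl erefl isT isT).
1-4: by clear; rewrite /dec; lra.
apply: (polygon_slab cover_sides 14 3 _ (dec 4992810) _ _ _ _ (dec 323313 / 100)
  _ erefl erefl isT isT).
1-4: by clear; rewrite /dec; lra.
by apply: (polygon_last_slab cover_sides 13 3 0 _ _ _ _ _ _ _
  erefl erefl erefl isT isT isT);
  clear; rewrite /dec; lra.
Qed.

End CoverArea.

Theorem mainTheorem1 (R : realType) :
  exists U : set (R * R),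
    universal_covering U /\ measurable U /\
    (area U <= (8441153%:R / 10000000%:R : R)%:E)%E.
Proof.
exists cover; split; first exact: cover_universal.
by split; [exact: measurable_polygon|exact: area_cover].
Qed.
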